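(* Let $m<n$ be positive integers, let $M\in\mathbb R^{n\times n}$ be symmetric positive definite, $A\in\mathbb R^{n\times n}$ arbitrary, and $B\in\mathbb R^{m\times n}$ of full rank $m$. For $\tau>0$ consider the implicit-explicit Euler scheme $$\tfrac1\tau Mv^{k+1}=(\tfrac1\tau M+A)v^k+B^{T}p^k+f^k,\qquad Bv^{k+1}=g^{k+1},$$ written (after shifting the time index in the second equation) as the difference-algebraic equation $\mathcal E x^{k+1}=\mathcal A x^k+h^k$ with $x^k=[v^k;p^k]$ and $$(\mathcal E,\mathcal A)=\left(\begin{bmatrix} \tfrac1\tau M & 0 \\ 0 & 0\end{bmatrix},\ \begin{bmatrix} \tfrac1\tau M+A & B^{T} \\ B & 0\end{bmatrix}\right).$$ Then for all sufficiently small $\tau>0$ the matrix pair $(\mathcal E,\mathcal A)$ is regular and equivalent to a pair of the form $$\left(\begin{bmatrix} I_{n-m} & 0 & 0 \\ 0 & 0 & 0 \\ 0 & I_m & 0\end{bmatrix},\ \begin{bmatrix} J & 0 & 0 \\ 0 & I_m & 0 \\ 0 & 0 & I_m\end{bmatrix}\right)$$ for some matrix $J\in\mathbb R^{(n-m)\times(n-m)}$. In particular, the scheme has Kronecker index $2$.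
   Context: A pair $(\mathcal E,\mathcal A)$ of square matrices of the same size is regular if $\det(\lambda\mathcal E-\mathcal A)$ is not the zero polynomial in $\lambda$. Two pairs $(\mathcal E,\mathcal A)$ and $(\tilde{\mathcal E},\tilde{\mathcal A})$ are equivalent if $\tilde{\mathcal E}=P\mathcal E Q$ and $\tilde{\mathcal A}=P\mathcal A Q$ for some nonsingular matrices $P,Q$. A regular pair is equivalent to a pair $$\left(\begin{bmatrix} I & 0 \\ 0 & N\end{bmatrix},\begin{bmatrix} J & 0 \\ 0 & I\end{bmatrix}\right)$$ with $N$ nilpotent. The index of the pair, equivalently the Kronecker index of the difference-algebraic equation $\mathcal E x^{k+1}=\mathcal A x^k+h^k$, is the integer $\nu$ with $N^\nu=0$ and $N^{\nu-1}\neq0$ (in particular, the index is $1$ if $N=0$ is present with positive size). *)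

(* Defs.v *)
From mathcomp Require Import all_boot all_order all_algebra.
From mathcomp Require Import reals.

Set Implicit Arguments.
Unset Strict Implicit.
Unset Printing Implicit Defensive.

Import Order.TTheory GRing.Theory Num.Theory.
Local Open Scope ring_scope.

Definition sympos_def (R : realType) (n : nat) (M : 'M[R]_n) : Prop :=
  M^T = M /\ forall x : 'cV[R]_n, x != 0 -> 0 < (x^T *m M *m x) 0 0.

Definition mxpair (R : realType) (d : nat) : Type := ('M[R]_d * 'M[R]_d)%type.

Definition regular_pair (R : realType) (d : nat) (EA : mxpair R d) : Prop :=
  \det ('X *: map_mx polyC EA.1 - map_mx polyC EA.2) != 0 :> {poly R}.

Definition equiv_pair (R : realType) (d : nat) (EA EA' : mxpair R d) : Prop :=
  exists P Q : 'M[R]_d,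
    [/\ P \in unitmx, Q \in unitmx,
        EA'.1 = P *m EA.1 *m Q & EA'.2 = P *m EA.2 *m Q].

(* Transport along an equality of sizes; the entries are unchanged. *)
Definition cast_pair (R : realType) (d d' : nat) (e : d = d')
    (EA : mxpair R d) : mxpair R d' :=
  (castmx (e, e) EA.1, castmx (e, e) EA.2).

Definition weierstrass_pair (R : realType) (r s : nat)
    (J : 'M[R]_r) (N : 'M[R]_s) : mxpair R (r + s) :=
  (block_mx 1%:M 0 0 N, block_mx J 0 0 1%:M).

(* The index of nilpotency of N does not depend on the chosen Weierstrass form.
   The two conditions on N force 0 < nu and 0 < s: for nu = 0 they contradict
   each other, and for s = 0 every s x s matrix is zero. *)
Definition has_kronecker_index (R : realType) (d : nat) (EA : mxpair R d)
    (nu : nat) : Prop :=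
  exists (r s : nat) (e : (r + s)%N = d) (J : 'M[R]_r) (N : 'M[R]_s),
    [/\ equiv_pair EA (cast_pair e (weierstrass_pair J N)),
        N ^+ nu = 0 & N ^+ nu.-1 <> 0].

Definition imex_pair (R : realType) (m n : nat) (M A : 'M[R]_n)
    (B : 'M[R]_(m, n)) (tau : R) : mxpair R (n + m) :=
  (block_mx (tau^-1 *: M) 0 0 0, block_mx (tau^-1 *: M + A) B^T B 0).

Definition imex_euler_scheme (R : realType) (m n : nat) (M A : 'M[R]_n)
    (B : 'M[R]_(m, n)) (tau : R) (v f : nat -> 'cV[R]_n)
    (p g : nat -> 'cV[R]_m) : Prop :=
  forall k : nat,
    tau^-1 *: M *m v k.+1 = (tau^-1 *: M + A) *m v k + B^T *m p k + f k
    /\ B *m v k.+1 = g k.+1.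

Definition dae (R : realType) (d : nat) (EA : mxpair R d)
    (h x : nat -> 'cV[R]_d) : Prop :=
  forall k : nat, EA.1 *m x k.+1 = EA.2 *m x k + h k.

(* The time shift in the constraint B v^{k+1} = g^{k+1} adds the equation
   B v^0 = g^0, i.e. consistency of the initial value. *)
Lemma imex_euler_dae (R : realType) (m n : nat) (M A : 'M[R]_n)
    (B : 'M[R]_(m, n)) (tau : R) (v f : nat -> 'cV[R]_n)
    (p g : nat -> 'cV[R]_m) :
  imex_euler_scheme M A B tau v f p g /\ B *m v 0%N = g 0%N <->
  dae (imex_pair M A B tau) (fun k => col_mx (f k) (- g k))
      (fun k => col_mx (v k) (p k)).
Proof.
have E k : (imex_pair M A B tau).1 *m col_mx (v k.+1) (p k.+1) =
           (imex_pair M A B tau).2 *m col_mx (v k) (p k) + col_mx (f k) (- g k)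
  <-> tau^-1 *: M *m v k.+1 = (tau^-1 *: M + A) *m v k + B^T *m p k + f k
      /\ B *m v k = g k.
  rewrite /= !mul_block_col !mul0mx !addr0 add_col_mx; split.
    by case/eq_col_mx=> -> /esym/eqP; rewrite subr_eq0 => /eqP.
  by case=> -> ->; rewrite subrr.
split=> [[S S0] k|D].
  by apply/E; split; [case: (S k) | case: k => [//|k]; case: (S k)].
split=> [k|]; last by have /E[] := D 0%N.
by split; [have /E[] := D k | have /E[] := D k.+1].
Qed.

Lemma canonical_dim (m n : nat) : (m < n)%N -> (n - m + (m + m) = n + m)%N.
Proof. by move=> /ltnW le_mn; rewrite addnA subnK. Qed.

Definition imex_canonical_pair (R : realType) (m n : nat) (hmn : (m < n)%N)
    (J : 'M[R]_(n - m)) : mxpair R (n + m) :=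
  cast_pair (canonical_dim hmn)
    (block_mx 1%:M 0 0 (block_mx (0 : 'M_m) 0 1%:M 0),
     block_mx J 0 0 (block_mx (1%:M : 'M_m) 0 0 1%:M)).

(* Main.v *)
Require Import Defs.
From mathcomp Require Import all_boot all_order all_algebra.
From mathcomp Require Import reals.

Set Implicit Arguments.
Unset Strict Implicit.
Unset Printing Implicit Defensive.

Import Order.TTheory GRing.Theory Num.Theory.
Local Open Scope ring_scope.

(** Split the velocity space as ker B + C(R^m), where C is a right inverse of B
    whose image is M-orthogonal to ker B; explicitly,
    C = M^-1 B^T (B M^-1 B^T)^-1 ([ortho_right_inverse]).  Let the columns of K
    be a basis of ker B ([kernel_basis]) and write H = M / tau + A.  In the
    coordinates v = K y + C z the pair becomes
    [[
      E = [ M_K  0    0 ]        A = [ K^T H K  K^T H C  0 ]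
          [ 0    M_C  0 ]            [ C^T H K  C^T H C  I ]
          [ 0    0    0 ]            [ 0        I        0 ]
    ]]
    with M_K = K^T M K / tau and M_C = C^T M C / tau, both nonsingular because M
    is positive definite.  The third block row of E and its third block column
    vanish, so the identity blocks of A clear K^T H C, C^T H C and C^T H K
    without changing E.  It remains to exchange the last two block rows and to
    normalise M_K and M_C; this gives J = M_K^-1 K^T H K, and the nilpotent part
    squares to zero but is nonzero.

    The matrices P and Q of the whole reduction are written down at once in
    [imex_reduction], and their nonsingularity needs no separate computation:
    det (lambda E' - A') = det P det (lambda E - A) det Q, and the left-hand
    side is a nonzero polynomial for every pair in block form
    ([weierstrass_pair_regular]).  The same identity yields the regularity of
    the original pair ([reduction_to_regular]). *)

(** * Regularity and equivalence of matrix pairs *)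

(** The determinant is the product of the characteristic polynomial of J and of
    det (X N - 1), whose value at X = 0 is a sign. *)
Lemma weierstrass_pair_regular (R : realType) (r s : nat)
    (J : 'M[R]_r) (N : 'M[R]_s) : regular_pair (weierstrass_pair J N).
Proof.
rewrite /regular_pair /= !map_block_mx !map_mx0 !map_mx1.
rewrite scale_block_mx opp_block_mx add_block_mx !scaler0 !oppr0 !addr0.
rewrite det_ublock mulf_neq0 //.
  have -> : 'X *: 1%:M - map_mx polyC J = char_poly_mx J.
    by rewrite /char_poly_mx scalemx1.
  exact: monic_neq0 (char_poly_monic J).
apply/eqP => /(congr1 (horner_eval 0)); rewrite -det_map_mx.
rewrite [RHS]/horner_eval horner0 map_mxB map_mx1.
have -> : map_mx (horner_eval 0) ('X *: map_mx polyC N) = 0.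
  by apply/matrixP => i j; rewrite !mxE /horner_eval hornerM hornerX mul0r.
rewrite sub0r -scaleN1r detZ det1 mulr1 => /eqP.
by rewrite expf_eq0 oppr_eq0 oner_eq0 andbF.
Qed.

(** Comparing determinants of the pencils shows that neither factor can be
    singular.  The sizes d and d' are kept apart so that the two pairs may carry
    different block decompositions, with P and Q partitioned accordingly. *)
Lemma reduction_to_regular (R : realType) (d d' : nat) (e : d' = d)
    (EA : mxpair R d) (EA' : mxpair R d')
    (P : 'M[R]_(d', d)) (Q : 'M[R]_(d, d')) :
  regular_pair EA' -> P *m EA.1 *m Q = EA'.1 -> P *m EA.2 *m Q = EA'.2 ->
  regular_pair EA /\ equiv_pair EA (cast_pair e EA').
Proof.
case: d / e P Q EA => P Q EA reg' eqE eqA.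
have eq_det : (\det P)%:P *
    \det ('X *: map_mx polyC EA.1 - map_mx polyC EA.2) * (\det Q)%:P =
    \det ('X *: map_mx polyC EA'.1 - map_mx polyC EA'.2).
  rewrite -!det_map_mx -!det_mulmx mulmxBr mulmxBl -scalemxAr -scalemxAl.
  by rewrite -!map_mxM eqE eqA.
move: reg'; rewrite /regular_pair -eq_det !mulf_eq0 !polyC_eq0 !negb_or.
case/andP=> /andP[detP reg] detQ; split=> //.
by exists P, Q; split; rewrite ?unitmxE ?unitfE // /cast_pair /= castmx_id.
Qed.

Lemma imex_canonical_pairE (R : realType) (m n : nat) (hmn : (m < n)%N)
    (J : 'M[R]_(n - m)) :
  imex_canonical_pair hmn J = cast_pair (canonical_dim hmn)
    (weierstrass_pair J (block_mx (0 : 'M_m) 0 1%:M 0)).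
Proof. by rewrite /imex_canonical_pair -scalar_mx_block. Qed.

Lemma canonical_nilpotent_sq (R : realType) (m : nat) :
  (block_mx (0 : 'M[R]_m) 0 1%:M (0 : 'M[R]_m)) ^+ 2 = 0.
Proof.
rewrite expr2 -[LHS]/(_ *m _) mulmx_block !mulmx0 !mul0mx !addr0.
exact: block_mx0.
Qed.

Lemma canonical_nilpotent_neq0 (R : realType) (m : nat) : (0 < m)%N ->
  block_mx (0 : 'M[R]_m) 0 1%:M (0 : 'M[R]_m) <> 0.
Proof.
case: m => // m _ /(congr1 dlsubmx); rewrite block_mxKdl.
move/matrixP/(_ 0 0)/eqP; rewrite !mxE eqxx.
by rewrite (oner_eq0 R).
Qed.

(** * The splitting of the velocity space *)

(** If u annihilates L M L^T, then x = (u L)^T satisfies x^T M x = 0, so x = 0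
    by definiteness and u = 0 by independence of the rows of L. *)
Lemma sympos_gram_unit (R : realType) (k n : nat) (M : 'M[R]_n)
    (L : 'M[R]_(k, n)) :
  sympos_def M -> row_free L -> L *m M *m L^T \in unitmx.
Proof.
move=> [_ posM] freeL; rewrite -row_free_unit; apply: inj_row_free => u uG0.
suff uL0 : u *m L = 0.
  by apply: (row_free_inj freeL); rewrite uL0 mul0mx.
apply/eqP; rewrite -trmx_eq0; apply/negP => /negP /posM.
have -> : (u *m L)^T^T *m M *m (u *m L)^T = u *m (L *m M *m L^T) *m u^T.
  by rewrite trmxK trmx_mul !mulmxA.
by rewrite uG0 mul0mx mxE ltxx.
Qed.

Lemma kernel_basis (R : realType) (m n : nat) (B : 'M[R]_(m, n)) :
  \rank B = m ->
  exists2 K : 'M[R]_(n, n - m), B *m K = 0 & row_free K^T.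
Proof.
move=> rkB.
have [L LB freeL] : exists2 L : 'M[R]_(n - m, n), L *m B^T = 0 & row_free L.
  have <- : \rank (kermx B^T) = (n - m)%N by rewrite mxrank_ker mxrank_tr rkB.
  exists (row_base (kermx B^T)); last exact: row_base_free.
  by apply/sub_kermxP; rewrite eq_row_base.
exists L^T; last by rewrite trmxK.
by apply: trmx_inj; rewrite trmx_mul trmxK LB trmx0.
Qed.

(** C = M^-1 B^T (B M^-1 B^T)^-1.  The middle factor is a Gram matrix of M, for
    the rows of B M^-1, hence nonsingular; and M C = B^T (B M^-1 B^T)^-1 is
    annihilated from the left by K^T as soon as B K = 0. *)
Lemma ortho_right_inverse (R : realType) (m n : nat) (M : 'M[R]_n)
    (B : 'M[R]_(m, n)) :
  sympos_def M -> \rank B = m ->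
  exists2 C : 'M[R]_(n, m), B *m C = 1%:M &
    forall (k : nat) (K : 'M[R]_(n, k)), B *m K = 0 -> K^T *m M *m C = 0.
Proof.
move=> posM rkB; have [symM _] := posM.
have unitM : M \in unitmx.
  have := sympos_gram_unit (L := 1%:M) posM.
  by rewrite mul1mx trmx1 mulmx1 row_free_unit unitmx1; apply.
set S := B *m invmx M *m B^T.
have unitS : S \in unitmx.
  have -> : S = (B *m invmx M) *m M *m (B *m invmx M)^T.
    by rewrite mulmxKV // trmx_mul trmx_inv symM mulmxA.
  apply: sympos_gram_unit => //.
  by rewrite /row_free mxrankMfree ?rkB // row_free_unit unitmx_inv.
exists (invmx M *m B^T *m invmx S); first by rewrite !mulmxA mulmxV.
move=> k K BK0; rewrite !mulmxA mulmxK // -trmx_mul BK0.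
by rewrite trmx0 mul0mx.
Qed.

(** * Reduction of the scheme *)

Lemma imex_reduction (R : realType) (m n : nat) (M A : 'M[R]_n)
    (B : 'M[R]_(m, n)) (tau : R) :
  sympos_def M -> \rank B = m -> tau != 0 ->
  exists (J : 'M[R]_(n - m)) (P : 'M[R]_(n - m + (m + m), n + m))
      (Q : 'M[R]_(n + m, n - m + (m + m))),
    let W := weierstrass_pair J (block_mx (0 : 'M_m) 0 1%:M 0) in
    P *m (imex_pair M A B tau).1 *m Q = W.1 /\
    P *m (imex_pair M A B tau).2 *m Q = W.2.
Proof.
move=> posM rkB tau0; have [symM _] := posM.
have [K BK freeK] := kernel_basis rkB.
have [C BC orthC] := ortho_right_inverse posM rkB.
have KMC := orthC _ _ BK.
have CMK : C^T *m M *m K = 0.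
  by apply: trmx_inj; rewrite !trmx_mul trmxK symM mulmxA KMC trmx0.
have KB : K^T *m B^T = 0 by rewrite -trmx_mul BK trmx0.
have CB : C^T *m B^T = 1%:M by rewrite -trmx_mul BC trmx1.
have unit_scaled k (L : 'M[R]_(k, n)) : row_free L ->
    L *m (tau^-1 *: M) *m L^T \in unitmx.
  move=> freeL; rewrite -scalemxAr -scalemxAl unitmxZ ?unitfE ?invr_eq0 //.
  exact: sympos_gram_unit.
have unitMK := unit_scaled _ _ freeK.
have unitMC : C^T *m (tau^-1 *: M) *m C^T^T \in unitmx.
  by apply: unit_scaled; apply/row_freeP; exists B^T.
rewrite !trmxK in unitMK unitMC.
rewrite /imex_pair /=; set H := tau^-1 *: M + A; set Mt := tau^-1 *: M.
have KMtC : K^T *m Mt *m C = 0 by rewrite -scalemxAr -scalemxAl KMC scaler0.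
have CMtK : C^T *m Mt *m K = 0 by rewrite -scalemxAr -scalemxAl CMK scaler0.
set MK := K^T *m Mt *m K in unitMK.
set MC := C^T *m Mt *m C in unitMC.
exists (invmx MK *m K^T *m H *m K).
(* The block rows of P: the kernel rows of the momentum equation; the
   constraint; the complementary rows of the momentum equation.  The second
   block column of the first and of the third subtracts the multiple of the
   constraint that clears K^T H C and C^T H C; the entry - C^T H K of Q clears
   C^T H K.  The factor M_C in Q undoes, on the identity block of A, the
   scaling of the third block row by M_C^-1. *)
exists (block_mx (invmx MK *m K^T) (- (invmx MK *m K^T *m H *m C))
   (col_mx 0 (invmx MC *m C^T)) (col_mx 1%:M (- (invmx MC *m C^T *m H *m C)))).
exists (block_mx K (row_mx C 0) (- (C^T *m H *m K)) (row_mx 0 MC)).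
split.
  rewrite mulmx_block !mulmx0 !addr0 mulmx_block !mul0mx !addr0.
  rewrite mul_col_mx mul0mx !mul_mx_row !mul_col_mx !mulmx0 !mul0mx.
  have e1 : invmx MK *m K^T *m Mt *m K = 1%:M.
    by rewrite -!mulmxA (mulmxA _ Mt) -/MK mulVmx.
  have e2 : invmx MK *m K^T *m Mt *m C = 0.
    by rewrite -!mulmxA (mulmxA _ Mt) KMtC mulmx0.
  have e3 : invmx MC *m C^T *m Mt *m K = 0.
    by rewrite -!mulmxA (mulmxA _ Mt) CMtK mulmx0.
  have e4 : invmx MC *m C^T *m Mt *m C = 1%:M.
    by rewrite -!mulmxA (mulmxA _ Mt) -/MC mulVmx.
  by rewrite e1 e2 e3 e4 row_mx0 -block_mxEh col_mx0.
have MKB : invmx MK *m K^T *m B^T = 0 by rewrite -mulmxA KB mulmx0.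
have MCB : invmx MC *m C^T *m B^T = invmx MC by rewrite -mulmxA CB mulmx1.
(* Expanding the products below must not look inside these three matrices. *)
clearbody MK MC H.
(* Multiply on the right by Q first, so that B K = 0 and B C = 1 apply. *)
rewrite -mulmxA mulmx_block !mul_mx_row !mul0mx !mulmx0 BK BC !addr0.
rewrite !add_row_mx !addr0 !add0r mulmx_block !mulmx0 !addr0.
rewrite !mul_mx_row !mul_col_mx !mulmx0 !mul0mx.
rewrite !mulmxDr !mulmxN !mulNmx !mulmx1 !mulmxA MKB MCB !mul0mx !oppr0 !addr0.
rewrite mulVmx // subrr !add_row_mx !add_col_mx !addr0 !add0r !subrr.
by rewrite row_mx0 col_mx0 -block_mxEh -scalar_mx_block.
Qed.

Theorem mainTheorem2 (R : realType) (m n : nat) (hm : (0 < m)%N)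
    (hmn : (m < n)%N) (M A : 'M[R]_n) (B : 'M[R]_(m, n))
    (hM : sympos_def M) (hB : \rank B = m) :
  exists2 tau0 : R, 0 < tau0 &
    forall tau : R, 0 < tau -> tau < tau0 ->
      [/\ regular_pair (imex_pair M A B tau),
          exists J : 'M[R]_(n - m),
            equiv_pair (imex_pair M A B tau) (imex_canonical_pair hmn J)
        & has_kronecker_index (imex_pair M A B tau) 2].
Proof.
(* The reduction inverts only M_K and M_C, never K^T H K, so that no bound on
   tau arises and the choice of 1 is arbitrary. *)
exists 1 => // tau tau_gt0 _.
have [J [P [Q [eqE eqA]]]] := imex_reduction A hM hB (lt0r_neq0 tau_gt0).
have [reg equiv] := reduction_to_regular (canonical_dim hmn)
  (weierstrass_pair_regular _ _) eqE eqA.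
split=> //; first by exists J; rewrite imex_canonical_pairE.
exists (n - m)%N, (m + m)%N, (canonical_dim hmn), J, (block_mx 0 0 1%:M 0).
split=> //; first exact: canonical_nilpotent_sq.
exact: canonical_nilpotent_neq0.
Qed.
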